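(* Let $P_1\neq P_2$ be lattice points in $\mathbb{Z}^2$ and let $\mathcal{S}(P_1,P_2)=\{Q\in\mathbb{Z}^2 : |Q-P_1|\in\mathbb{Z},\ |Q-P_2|\in\mathbb{Z}\}$. Put $P=P_2-P_1$. Suppose that $P$ cannot be transformed, by changing the signs of its coordinates and/or swapping its two coordinates, into one of the points $(0,1),(1,1),(0,2),(1,2),(2,2),(2,4)$. Then for every finite union $\mathcal{L}$ of lines in $\mathbb{R}^2$, the set $\mathcal{S}(P_1,P_2)\setminus\mathcal{L}$ is infinite. Moreover, writing $O=(0,0)$ and $\mathcal{S}=\mathcal{S}(O,P)$, in the exceptional cases one has: (i) if $P=(0,1)$, $\mathcal{S}$ consists of the integer points on the $y$-axis; (ii) if $P=(1,1)$, $\mathcal{S}$ is infinite and contained in the line $x+y=1$; (iii) if $P=(0,2)$, $\mathcal{S}$ consists of the integer points on the $y$-axis; (iv) if $P=(1,2)$, $\mathcal{S}=\{(1,0),(0,2)\}$; (v) if $P=(2,2)$, $\mathcal{S}$ is infinite and contained in the line $x+y=2$; (vi) if $P=(2,4)$, $\mathcal{S}$ is the union of an infinite set contained in the line $x+2y=5$ and the set $\{(0,2),(4,0),(-1,0),(3,4)\}$.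
   Context: $|\cdot|$ denotes the usual Euclidean norm on $\mathbb{R}^2$. A lattice point is a point of $\mathbb{Z}^2$. Note that $\mathcal{S}(P_1,P_2)$ is the translate by $P_1$ of $\mathcal{S}(O,P_2-P_1)$.
   Formalization: In (vi) the points (0,2) and (4,0) are replaced by (2,0) and (0,4): the printed points are at distances 2√2 and 2√5 from (2,4), so they are not in S, while (2,0) and (0,4) are. *)

(* Defs.v *)
From mathcomp Require Import all_boot all_order all_algebra.
From mathcomp Require Import all_classical all_reals.

Set Implicit Arguments.
Unset Strict Implicit.
Unset Printing Implicit Defensive.

Import Order.TTheory GRing.Theory Num.Theory.

Local Open Scope classical_set_scope.
Local Open Scope ring_scope.

Notation lattice_point := (int * int)%type.

Definition lattice_embed (R : realType) (Q : lattice_point) : R * R :=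
  (Q.1%:~R, Q.2%:~R).

(* The library's norm on [R * R] is the sup norm, hence this definition. *)
Definition enorm (R : realType) (z : R * R) : R :=
  Num.sqrt (z.1 ^+ 2 + z.2 ^+ 2).

Definition latS (R : realType) (P1 P2 : lattice_point) : set lattice_point :=
  [set Q | enorm (lattice_embed R (Q - P1)) \is a Num.int /\
           enorm (lattice_embed R (Q - P2)) \is a Num.int].

Definition is_line (R : realType) (l : set (R * R)) : Prop :=
  exists a b c : R, (a, b) <> (0, 0) /\
    l = [set z | a * z.1 + b * z.2 = c].

Definition finite_union_of_lines (R : realType) (L : set (R * R)) : Prop :=
  exists F : set (set (R * R)),
    [/\ finite_set F, F `<=` @is_line R & L = \bigcup_(l in F) l].

Definition sign_swap (s e1 e2 : bool) (P : lattice_point) : lattice_point :=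
  let P' := ((-1) ^+ e1 * P.1, (-1) ^+ e2 * P.2) in
  if s then (P'.2, P'.1) else P'.

Definition exceptional_points : seq lattice_point :=
  [:: (0, 1); (1, 1); (0, 2); (1, 2); (2, 2); (2, 4)].

Definition exceptional (P : lattice_point) : Prop :=
  exists s e1 e2 : bool, sign_swap s e1 e2 P \in exceptional_points.

(* Main.v *)
Require Import Defs.
From mathcomp Require Import all_boot all_order all_algebra.
From mathcomp Require Import all_classical all_reals.
From mathcomp Require Import zify ring.

(** Let P = (a, b), N = a^2 + b^2. For an integral d with d^2 <= N, the points
    Q with |Q| - |Q - P| = d form a branch of a hyperbola (a line when d = 0 or
    d^2 = N), and by the triangle inequality every point of S lies on one of
    these finitely many branches. With s = |Q| + |Q - P| and
    W = det(P, 2 Q - P) the hyperbola becomes W^2 = D (s^2 - N), D = N - d^2.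
    When d <> 0 and D > 0 is not a square, one integral point Q generates
    infinitely many, by the units of Z[sqrt D] congruent to 1 modulo 2 N, and
    every line meets the hyperbola in at most two of them.
    For 0 <= a <= b the point Q = (a + c, 0), where b^2 = e (2 c + e), has
    d = a - e and D = b^2 + 2 a e - e^2; a suitable e in {1, -1, 2, -2} gives a
    nonsquare D with d <> 0 unless P is exceptional. In the exceptional cases
    the finitely many possible d are examined one by one. *)

Import Order.TTheory GRing.Theory Num.Theory.

Local Open Scope classical_set_scope.
Local Open Scope ring_scope.

(** * Nonsquare integers and the pigeonhole principle *)

Definition nonsquare (D : int) := forall k : int, k ^+ 2 <> D.

Lemma nonsquare_ratio (D x y : int) :
  nonsquare D -> y != 0 -> x ^+ 2 <> D * y ^+ 2.
Proof.
move=> Dns y0 xy.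
have /dvdzP[k xk] : (y %| x)%Z.
  rewrite dvdzE -(@dvdn_pexp2r _ _ 2) // -!abszX -dvdzE xy.
  exact: dvdz_mull.
apply: (Dns k); apply: (@mulIf _ (y ^+ 2)); first by rewrite expf_neq0.
by rewrite -xy xk exprMn.
Qed.

Lemma nat_to_finite_collision (T : finType) (f : nat -> T) :
  exists i j, (i < j)%N /\ f i = f j.
Proof.
have /injectivePn[i [j ij fij]] : ~~ injectiveb (fun i : 'I_(#|T|.+1) => f i).
  apply/negP => /injectiveP /leq_card; rewrite card_ord ltnn //.
have [lt|gt|/val_inj e] := ltngtP i j.
- by exists i, j.
- by exists j, i.
- by rewrite e eqxx in ij.
Qed.

(** * Solvability of Pell's equation *)

Section Pell.
Variable D : int.
Hypotheses (D_gt0 : 0 < D) (Dns : nonsquare D).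

Let form (u : int * int) : int := u.1 ^+ 2 - D * u.2 ^+ 2.
Let polar (u v : int * int) : int := u.1 * v.1 - D * (u.2 * v.2).

(* Conway's river of the form [x^2 - D y^2]: a basis of [Z^2] on which the form
   takes values of opposite signs. The Gram matrices of these bases have bounded
   entries, so two of them coincide, which gives an automorph of the form. *)
Definition river_step (B : (int * int) * (int * int)) :=
  let w := B.1 + B.2 in
  if 0 < form w then (w, B.2) else (B.1, w).

Definition river (n : nat) := iter n river_step ((1, 0), (0, 1)).

Definition river_inv (B : (int * int) * (int * int)) :=
  [/\ [/\ 0 <= B.1.1, 0 <= B.1.2, 0 <= B.2.1 & 0 <= B.2.2],
      B.1.1 * B.2.2 - B.1.2 * B.2.1 = 1, 0 < form B.1 & form B.2 < 0].

Lemma river_invP n : river_inv (river n).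
Proof.
elim: n => [|n]; first by rewrite /river_inv /form /=; split=> //; lia.
rewrite /river iterS -/(river n); case: (river n) => [[p q] [r t]].
rewrite /river_inv /river_step /form /= => -[[p0 q0 r0 t0] det fu fv].
case: ifPn => [fw|]; first by split=> //=; [split; lia | nia].
(* The form has no nontrivial zero because [D] is not a square, so one of the two signs always
   occurs. *)
rewrite -leNgt le_eqVlt => /orP[/eqP fw|fw].
  exfalso; have qt : q + t != 0 by nia.
  apply: (nonsquare_ratio D (p + r) _ Dns qt); lia.
by split=> //=; [split; lia | nia].
Qed.

(** It grows strictly along the river, so two bases with the same Gram matrix are still distinct. *)
Definition weight (B : (int * int) * (int * int)) :=
  B.1.1 + B.1.2 + B.2.1 + B.2.2.

Lemma weight_river n : weight (river n) < weight (river n.+1).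
Proof.
have := river_invP n.
rewrite /river iterS -/(river n); case: (river n) => [[p q] [r t]].
rewrite /river_inv /river_step /form /weight /= => -[[p0 q0 r0 t0] det fu fv].
by case: ifPn => _ /=; nia.
Qed.

Lemma weight_river_lt i j : (i < j)%N -> weight (river i) < weight (river j).
Proof.
have h := @homo_ltn _ (fun n => weight (river n)) (fun x y => x < y).
by move: i j; apply: h => [y x z|n]; [exact: lt_trans | exact: weight_river].
Qed.

(** A basis of determinant 1 preserves the discriminant: [H ^+ 2 - A * C = D]. As [A > 0 > C], both
    [H ^+ 2] and [A * (- C)] are at most [D]. *)
Lemma river_bounds n (B := river n) :
  [/\ 0 < form B.1 <= D, 0 < - form B.2 <= D & - D <= polar B.1 B.2 <= D].
Proof.
have := river_invP n; rewrite -/B.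
case: B => [[p q] [r t]].
rewrite /river_inv /form /polar /= => -[[p0 q0 r0 t0] det fu fv].
set A := _ - _ in fu *; set C := _ - _ in fv *; set H := _ - _.
have : H ^+ 2 - A * C = D.
  by rewrite -[RHS]mulr1 -(expr1n _ 2) -det /H /A /C; ring.
move: (A) (C) (H) fu fv => {}A {}C {}H fu fv E.
by split; apply/andP; split; nia.
Qed.

Lemma pell_exists : exists p q : int, [/\ 1 < p, 0 < q & p ^+ 2 - D * q ^+ 2 = 1].
Proof.
suff [p [q [q0 pq]]] : exists p q : int, q != 0 /\ p ^+ 2 - D * q ^+ 2 = 1.
  exists `|p|, `|q|; rewrite !real_normK ?num_real //; split=> //; last first.
  - by rewrite normr_gt0.
  - have q2 : 0 < q ^+ 2 by rewrite exprn_even_gt0.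
    have : 1 < `|p| ^+ 2 by rewrite real_normK ?num_real //; nia.
    by have := normr_ge0 p; nia.
pose K := `|D|%N.
(* The Gram matrix as an element of a finite type. [polar] may be negative, hence the shift by [D];
   by [river_bounds] no [inord] truncates. *)
pose enc n := (inord `|form (river n).1|%N : 'I_K.+1,
               inord `|form (river n).2|%N : 'I_K.+1,
               inord (absz (polar (river n).1 (river n).2 + D)) : 'I_(2 * K).+1).
have [i [j [ij eij]]] := nat_to_finite_collision _ enc.
have wij := weight_river_lt _ _ ij.
have [Ai Ci Hi] := river_bounds i; have [Aj Cj Hj] := river_bounds j.
have Di := river_invP i; have Dj := river_invP j.
have [eA eC eH] : [/\ form (river i).1 = form (river j).1,
   form (river i).2 = form (river j).2 &
   polar (river i).1 (river i).2 = polar (river j).1 (river j).2].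
  case: eij => /(congr1 val) /=; rewrite !inordK; [|lia|lia] => e1.
  move=> /(congr1 val) /=; rewrite !inordK; [|lia|lia] => e2.
  move=> /(congr1 val) /=; rewrite !inordK; [|lia|lia] => e3.
  by split; lia.
move: {Ai Ci Hi Aj Cj Hj eij ij} wij eA eC eH Di Dj.
case: (river i) => [[p q] [r t]]; case: (river j) => [[p' q'] [r' t']].
rewrite /weight /river_inv /form /polar /=.
move=> wt eA eC eH [[p0 q0 r0 t0] det fu fv] [[p0' q0' r0' t0'] det' _ _].
(* The isometry taking basis [i] to basis [j] sends [(1, 0)], which is [t (p, q) - q (r, t)], to
   [(x, y)]. So [(x, y)] has form value 1. *)
pose x := t * p' - q * r'; pose y := t * q' - q * t'.
have xy : x ^+ 2 - D * y ^+ 2 = 1.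
  transitivity (t ^+ 2 * (p' ^+ 2 - D * q' ^+ 2)
     - 2 * (t * q) * (p' * r' - D * (q' * t'))
     + q ^+ 2 * (r' ^+ 2 - D * t' ^+ 2)); first by rewrite /x /y; ring.
  rewrite -eA -eC -eH; transitivity ((p * t - q * r) ^+ 2); first by ring.
  by rewrite det expr1n.
(* Let [(x2, y2)] be the image of [(0, 1)]. If [y = 0], determinant and orthogonality make the
   isometry plus or minus the identity: the first contradicts the weights, the second the
   nonnegative entries. *)
exists x, y; split=> //; apply/negP => /eqP y0.
pose x2 := p * r' - r * p'; pose y2 := p * t' - r * q'.
have dxy : x * y2 - y * x2 = 1.
  transitivity ((p * t - q * r) * (p' * t' - q' * r')); last by rewrite det det'.
  by rewrite /x /y /x2 /y2; ring.
have pxy : x * x2 - D * (y * y2) = 0.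
  transitivity (- (t * r) * (p' ^+ 2 - D * q' ^+ 2)
     + (t * p + q * r) * (p' * r' - D * (q' * t'))
     - p * q * (r' ^+ 2 - D * t' ^+ 2)); first by rewrite /x /y /x2 /y2; ring.
  rewrite -eA -eC -eH; ring.
have xy2 : x * y2 = 1 by rewrite -dxy y0; ring.
have x20 : x2 = 0.
  transitivity (y2 * (x * x2)); first by rewrite -[LHS]mul1r -xy2; ring.
  by move: pxy; rewrite y0 mul0r mulr0 subr0 => ->; rewrite mulr0.
have [ep eq er et] : [/\ p' = x * p + x2 * q, q' = y * p + y2 * q,
   r' = x * r + x2 * t & t' = y * r + y2 * t].
  split; rewrite -[LHS]mul1r -det /x /y /x2 /y2; ring.
rewrite y0 x20 !mul0r !(add0r, addr0) in ep eq er et.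
have [[xE yE]|[xE yE]] : (x = 1 /\ y2 = 1) \/ (x = -1 /\ y2 = -1).
- have := @intUnitRing.unitzPl x y2 (etrans (mulrC _ _) xy2).
  rewrite qualifE => /orP[]/eqP xE; [left | right]; split=> //.
    by rewrite -xy2 xE mul1r.
  by rewrite -xy2 xE mulN1r opprK.
- by move: wt; rewrite ep eq er et xE yE; lia.
- move: p0' q0'; rewrite ep eq xE yE !mulN1r !oppr_ge0 => p0' q0'.
  have p_eq0 : p = 0 by apply/eqP; rewrite eq_le p0' p0.
  have q_eq0 : q = 0 by apply/eqP; rewrite eq_le q0' q0.
  by move: det; rewrite p_eq0 q_eq0 !mul0r subr0.
Qed.

End Pell.

(** * Infinitely many integral points on one hyperbola *)

Definition integral_distances (a b x y m n : int) :=
  m ^+ 2 = x ^+ 2 + y ^+ 2 /\ n ^+ 2 = (x - a) ^+ 2 + (y - b) ^+ 2.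

(* An integral point on a hyperbola with focal difference [m - n <> 0] whose Pell
   discriminant is positive and not a square; [m] and [n] may be negative. *)
Definition has_base (a b : int) := exists x y m n : int,
  [/\ integral_distances a b x y m n, m != n, 0 < a ^+ 2 + b ^+ 2 - (m - n) ^+ 2 &
      nonsquare (a ^+ 2 + b ^+ 2 - (m - n) ^+ 2)].

(** Subtracting the two equations cancels the squares of [x] and [y]; for fixed [d] the rest is
    linear in [x], [y], [m]. *)
Lemma dist_linear (a b x y m n : int) (N : int := a ^+ 2 + b ^+ 2) (d : int := m - n) :
  integral_distances a b x y m n <->
  m ^+ 2 = x ^+ 2 + y ^+ 2 /\ 2 * (a * x + b * y) = 2 * d * m + (N - d ^+ 2).
Proof.
rewrite /integral_distances /N /d; split=> -[e1 e2]; split=> //.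
- have -> : 2 * (m - n) * m + (a ^+ 2 + b ^+ 2 - (m - n) ^+ 2) =
    m ^+ 2 - n ^+ 2 + a ^+ 2 + b ^+ 2 by ring.
  by rewrite e1 e2; ring.
- have -> : (x - a) ^+ 2 + (y - b) ^+ 2 =
    (x ^+ 2 + y ^+ 2) - 2 * (a * x + b * y) + a ^+ 2 + b ^+ 2 by ring.
  by rewrite e2 -e1; ring.
Qed.

Section Orbit.
Variables (a b d : int).
Let N : int := a ^+ 2 + b ^+ 2.
Let D : int := N - d ^+ 2.
Variables (p q : int).
Hypotheses (pq : N * p ^+ 2 + p = N * D * q ^+ 2).
Hypotheses (p_gt0 : 0 < p) (D_gt0 : 0 < D) (N_gt0 : 0 < N).

(* [al] and [be] are the increments, divided by [2 N], of [s] and [W] under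
   multiplication by the unit [1 + 2 N p + 2 N q sqrt D]; the hypothesis on [p]
   and [q] says that its norm is 1. *)
Definition orbit_step (z : int * int * int) : int * int * int :=
  let: (x, y, m) := z in
  let s := 2 * m - d in
  let W := 2 * (a * y - b * x) in
  let al := p * s + q * W in
  let be := p * W + q * D * s in
  (x + a * d * al - b * be, y + b * d * al + a * be, m + N * al).

(** The two inequalities make both terms of [al] nonnegative and the first one positive, so [m]
    increases at each step. *)
Definition orbit_inv (z : int * int * int) :=
  let: (x, y, m) := z in
  [/\ m ^+ 2 = x ^+ 2 + y ^+ 2, 2 * (a * x + b * y) = 2 * d * m + D,
      0 < 2 * m - d & 0 <= q * (a * y - b * x)].

Lemma orbit_stepP z : orbit_inv z ->
  orbit_inv (orbit_step z) /\ z.2 < (orbit_step z).2.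
Proof.
case: z => [[x y] m]; rewrite /orbit_inv /orbit_step.
set s := 2 * m - d; set W := 2 * (a * y - b * x).
set al := p * s + _; set be := p * W + _ => -[m2 lin s_gt0 qW].
have DsW : D * (s ^+ 2 - N) = W ^+ 2.
  have : (2 * (a * x + b * y)) ^+ 2 + W ^+ 2 = 4 * N * m ^+ 2.
    by rewrite m2 /N /W; ring.
  rewrite lin => /(canRL (addKr _)) ->; rewrite /s /D; ring.
have al_gt0 : 0 < al.
  have qWE : q * W = 2 * (q * (a * y - b * x)) by rewrite /W; ring.
  by rewrite ltr_wpDr ?mulr_gt0 // qWE mulr_ge0.
split; last by rewrite /= ltrDl mulr_gt0.
split.
- apply/eqP; rewrite -subr_eq0; apply/eqP.
  (* The new defect in the equation for [m] is a multiple of the norm equation [pq]. *)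
  transitivity ((D * s ^+ 2 - W ^+ 2) * (N * p ^+ 2 + p - N * D * q ^+ 2));
    last by rewrite pq subrr mulr0.
  transitivity (m ^+ 2 - (x ^+ 2 + y ^+ 2) + al * (2 * N * m - d * (2 * (a * x + b * y)))
    - be * W + N * (D * al ^+ 2 - be ^+ 2)); first by rewrite /W /D /N; ring.
  rewrite m2 lin /al /be /s /D; ring.
- transitivity (2 * (a * x + b * y) + 2 * N * d * al); first by rewrite /N; ring.
  by rewrite lin; ring.
- have -> : 2 * (m + N * al) - d = s + 2 * (N * al) by rewrite /s; ring.
  by rewrite addr_gt0 // !mulr_gt0.
- have -> : q * (a * (y + b * d * al + a * be) - b * (x + a * d * al - b * be)) =
    q * (a * y - b * x) + N * (2 * p * (q * (a * y - b * x)) + q ^+ 2 * D * s).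
    by rewrite /N /be /W; ring.
  have [p0 D0 N0 s0] := And4 (ltW p_gt0) (ltW D_gt0) (ltW N_gt0) (ltW s_gt0).
  rewrite addr_ge0 // mulr_ge0 // addr_ge0 //; first by rewrite mulr_ge0 // mulr_ge0.
  by rewrite mulr_ge0 // mulr_ge0 // sqr_ge0.
Qed.

End Orbit.

Lemma hyperbola_sequence (a b : int) : has_base a b ->
  exists d : int, [/\ d != 0, 0 < a ^+ 2 + b ^+ 2 - d ^+ 2 &
  exists x y m : nat -> int, {homo m : i j / (i < j)%N >-> i < j} /\
    forall k, integral_distances a b (x k) (y k) (m k) (m k - d)].
Proof.
move=> [x [y [m [n [xymn mn D_gt0 Dns]]]]].
wlog s_gt0 : m n xymn mn D_gt0 Dns / 0 < m + n.
  move=> wlg; have [||s0] := ltgtP 0 (m + n); first exact: wlg.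
    move=> s_lt0; apply: (wlg (- m) (- n)).
    - by rewrite /integral_distances !sqrrN.
    - by rewrite eqr_opp.
    - by rewrite -opprD sqrrN.
    - by rewrite -opprD sqrrN.
    - by lia.
  (* If [m + n = 0], then [d = 2 m] and the linear equation reads [2 (a x + b y) = N];
     Cauchy-Schwarz gives [N <= d ^+ 2], against [D > 0]. *)
  exfalso; have [e1 e2] := iffLR (dist_linear _ _ _ _ _ _) xymn.
  have nE : n = - m by lia.
  have : (2 * (a * x + b * y)) ^+ 2 <= 4 * (a ^+ 2 + b ^+ 2) * (x ^+ 2 + y ^+ 2).
    rewrite -subr_ge0 (_ : _ - _ = (2 * (a * y - b * x)) ^+ 2) ?sqr_ge0 //; ring.
  rewrite -e1 e2 nE opprK; move: D_gt0; rewrite nE opprK.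
  set N := a ^+ 2 + b ^+ 2.
  have -> : 2 * (m + m) * m + (N - (m + m) ^+ 2) = N by ring.
  have -> : (m + m) ^+ 2 = 4 * m ^+ 2 by ring.
  have := sqr_ge0 m; move: (m ^+ 2) N => M N M_ge0 D_gt0' /le_gtF/negP[].
  rewrite -subr_gt0 (_ : _ - _ = N * (N - 4 * M)); last by ring.
  by rewrite mulr_gt0 // -(subrK (4 * M) N) ltr_wpDr // mulr_ge0.
pose N : int := a ^+ 2 + b ^+ 2; pose d : int := m - n; pose D : int := N - d ^+ 2.
have N_gt0 : 0 < N by have := sqr_ge0 d; move: D_gt0; rewrite -/N -/d; lia.
have N2 : 2 * N != 0 by lia.
have [||p0 [q0 [p0_gt1 q0_gt0 pq0]]] := pell_exists (D * (2 * N) ^+ 2) _ _.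
- by rewrite mulr_gt0 // exprn_even_gt0.
- by move=> k; apply: nonsquare_ratio.
(* The square of the unit [p0 + 2 N q0 sqrt D] is [1 + 2 N p + 2 N q sqrt D] with [q = 2 p0 q0];
   squaring yields the congruence modulo [2 N]. *)
pose p := 4 * D * N * q0 ^+ 2.
pose W : int := a * y - b * x.
(* The unit or its inverse is used, according to the sign of [W]. *)
have [q [q2 qW]] : exists q, q ^+ 2 = 4 * p0 ^+ 2 * q0 ^+ 2 /\ 0 <= q * W.
  have [W0|W0] := leP 0 W; [exists (2 * p0 * q0) | exists (- (2 * p0 * q0))].
  - by split; [ring | rewrite !mulr_ge0 //; lia].
  - split; [ring | rewrite mulNr -mulrN !mulr_ge0 //; lia].
have pq : N * p ^+ 2 + p = N * D * q ^+ 2.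
  have p02 : p0 ^+ 2 = 1 + D * (2 * N) ^+ 2 * q0 ^+ 2.
    by rewrite -[LHS](subrK (D * (2 * N) ^+ 2 * q0 ^+ 2)) pq0.
  by rewrite q2 p02 /p; ring.
have p_gt0 : 0 < p by rewrite /p !mulr_gt0 // exprn_gt0.
have [e1 e2] := iffLR (dist_linear _ _ _ _ _ _) xymn.
pose z k := iter k (orbit_step a b d p q) (x, y, m).
have zP k : orbit_inv a b d q (z k).
  elim: k => [|k IH]; last by have [] := orbit_stepP a b d p q pq p_gt0 D_gt0 N_gt0 _ IH.
  by split=> //; rewrite /d; lia.
exists d; split=> //; first by rewrite subr_eq0.
exists (fun k => (z k).1.1), (fun k => (z k).1.2), (fun k => (z k).2); split.
  apply: homo_ltn => [u v w|k]; first exact: lt_trans.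
  by have [] := orbit_stepP a b d p q pq p_gt0 D_gt0 N_gt0 _ (zP k).
move=> k; have := zP k; case: (z k) => [[u v] w] /= [f1 f2 _ _].
by apply/dist_linear; rewrite subKr.
Qed.

(** * Base points for nonexceptional [P] *)

Lemma nonsquare_between (k D : int) : 0 <= k ->
  k ^+ 2 < D < (k + 2) ^+ 2 -> D != (k + 1) ^+ 2 -> nonsquare D.
Proof.
move=> k0 /andP[lo hi] mid j jD.
wlog j0 : j jD / 0 <= j => [wlg|].
  have [/wlg|/ltW j0] := leP 0 j; first exact.
  by apply: (wlg (- j)); rewrite ?sqrrN ?oppr_ge0.
have kj : k < j by rewrite -ltr_sqr ?nnegrE // jD.
have jk : j < k + 2 by rewrite -ltr_sqr ?nnegrE ?addr_ge0 // jD.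
by move/eqP: mid; apply; rewrite -jD; congr (_ ^+ 2); lia.
Qed.

(** The hypothesis on [c] says [c ^+ 2 + b ^+ 2 = (c + e) ^+ 2], so [(a + c, 0)] is at distance
    [|c + e|] from [(a, b)]. *)
Lemma has_base_axis (a b c e : int) : b ^+ 2 = e * (2 * c + e) -> a != e ->
  0 < b ^+ 2 + 2 * a * e - e ^+ 2 -> nonsquare (b ^+ 2 + 2 * a * e - e ^+ 2) ->
  has_base a b.
Proof.
move=> be ae; rewrite (_ : b ^+ 2 + _ - _ = a ^+ 2 + b ^+ 2 - (a - e) ^+ 2); last by ring.
move=> D_gt0 Dns; exists (a + c), 0, (a + c), (c + e).
rewrite (_ : a + c - (c + e) = a - e); last by ring.
split=> //; last by apply: contraNneq ae => h; apply/eqP; lia.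
by split; [ring | rewrite sub0r sqrrN be; ring].
Qed.

(** [e] has the parity of [b], so that [c] is an integer. [D] stays between [(b - 2) ^+ 2] and
    [(b + 2) ^+ 2]; at the six exceptional points the same choice of [e] gives [D <= 0] or
    [D = 4]. *)
Lemma has_base_sorted (a b : int) : 0 <= a <= b -> 0 < b ->
  (a, b) \notin exceptional_points -> has_base a b.
Proof.
move=> /andP[a0 ab] b0; rewrite /exceptional_points !inE !xpair_eqE => exc.
have [u [bE|bE]] : exists u : int, b = 2 * u + 1 \/ b = 2 * u.
  by exists (b %/ 2)%Z; lia.
(* For [a = 1] the choice [e = 1] would give [d = 0], hence [e = -1]. *)
- have [a1|a1] := eqVneq a 1.
  + apply: (@has_base_axis _ _ (- (2 * u ^+ 2 + 2 * u)) (- 1)).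
    * by rewrite bE; ring.
    * by rewrite a1.
    * by rewrite a1; nia.
    * by apply: (@nonsquare_between (b - 2)); rewrite ?a1; [lia| nia | nia].
  apply: (@has_base_axis _ _ (2 * u ^+ 2 + 2 * u) 1) => //.
  + by rewrite bE; ring.
  + by nia.
  + have [->|a0'] := eqVneq a 0.
      by apply: (@nonsquare_between (b - 2)); [lia| nia | nia].
    by apply: (@nonsquare_between b); [lia| nia | nia].
(* With [e = 2], [a = 1] would give the square [D = b ^+ 2] and [a = 2] would give [d = 0]; both
   take [e = -2]. *)
have [a12|a12] : (a = 1 \/ a = 2) \/ (a = 0 \/ 3 <= a) by lia.
- apply: (@has_base_axis _ _ (1 - u ^+ 2) (- 2)).
  + by rewrite bE; ring.
  + by lia.
  + by case: a12 => ->; nia.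
  + by case: a12 => aE; apply: (@nonsquare_between (b - 2)); rewrite ?aE; [lia|nia|nia|lia|nia|nia].
apply: (@has_base_axis _ _ (u ^+ 2 - 1) 2).
- by rewrite bE; ring.
- by lia.
- by case: a12 => [->|]; nia.
- case: a12 => [->|a3].
    by apply: (@nonsquare_between (b - 2)); [lia|nia|nia].
  by apply: (@nonsquare_between b); [lia|nia|nia].
Qed.

Lemma has_base_swap (a b : int) : has_base a b -> has_base b a.
Proof.
move=> [x [y [m [n [[e1 e2] mn D_gt0 Dns]]]]]; exists y, x, m, n.
by rewrite /integral_distances e1 e2 [b ^+ 2 + _]addrC; split=> //; split; rewrite addrC.
Qed.

Lemma has_base_opp (a b : int) : has_base a b -> has_base (- a) b.
Proof.
move=> [x [y [m [n [[e1 e2] mn D_gt0 Dns]]]]]; exists (- x), y, m, n.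
by rewrite /integral_distances e1 e2 !sqrrN -opprD sqrrN.
Qed.

Lemma has_base_nonexceptional (P : lattice_point) : P <> 0 -> ~ exceptional P ->
  has_base P.1 P.2.
Proof.
have hsgn (e : bool) (a b : int) : has_base ((-1) ^+ e * a) b -> has_base a b.
  by case: e; rewrite ?mul1r // mulN1r => /has_base_opp; rewrite opprK.
case: P => a b /= P0 Pexc.
have [s [e1 [e2 sorted]]] : exists s e1 e2 : bool,
    0 <= (sign_swap s e1 e2 (a, b)).1 <= (sign_swap s e1 e2 (a, b)).2.
  exists (`|b| < `|a|), (a < 0), (b < 0).
  rewrite /sign_swap /= -!normrEsign.
  by case: ltP => [/ltW|].
have nexc : sign_swap s e1 e2 (a, b) \notin exceptional_points.
  by apply/negP => h; apply: Pexc; exists s, e1, e2.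
have pos : 0 < (sign_swap s e1 e2 (a, b)).2.
  rewrite lt_neqAle andbC (le_trans _ (andP sorted).2) ?(andP sorted).1 //=.
  apply/negP => /eqP z; apply: P0.
  move: sorted z; rewrite /sign_swap; case: s e1 e2 {nexc} => [] [] [];
    rewrite /= ?mulN1r ?mul1r => sorted z; congr (_, _); lia.
move: (has_base_sorted _ _ sorted pos).
rewrite -surjective_pairing => /(_ nexc); rewrite /sign_swap.
case: s {sorted pos nexc} => /=.
- by move=> /has_base_swap /hsgn /has_base_swap /hsgn /has_base_swap.
- by move=> /hsgn /has_base_swap /hsgn /has_base_swap.
Qed.

(** * From integer equations to [latS], and avoidance of lines *)

Lemma enorm_intP (R : realType) (Q : lattice_point) :
  enorm (lattice_embed R Q) \is a Num.int <->
  exists m : int, 0 <= m /\ m ^+ 2 = Q.1 ^+ 2 + Q.2 ^+ 2.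
Proof.
rewrite /enorm /lattice_embed /= -!rmorphXn -rmorphD /=; split.
- move=> /intrP[m Em]; exists m; split.
    by rewrite -(ler0z R) -Em sqrtr_ge0.
  apply: (@intr_inj R); rewrite rmorphXn /= -Em sqr_sqrtr // ler0z.
  by rewrite addr_ge0 ?sqr_ge0.
- move=> [m [m0 <-]].
  by rewrite rmorphXn /= sqrtr_sqr ger0_norm ?ler0z // intr_int.
Qed.

Lemma latSP (R : realType) (P Q : lattice_point) :
  latS R (0, 0) P Q <-> exists m n : int,
    [/\ 0 <= m, 0 <= n & integral_distances P.1 P.2 Q.1 Q.2 m n].
Proof.
rewrite /latS /= !enorm_intP subr0; split.
- by move=> [[m [m0 Em]] [n [n0 En]]]; exists m, n.
- by move=> [m [n [m0 n0 [Em En]]]]; split; [exists m | exists n].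
Qed.

Lemma latS_translate (R : realType) (P1 P2 Q : lattice_point) :
  latS R (0, 0) (P2 - P1) Q -> latS R P1 P2 (P1 + Q).
Proof.
by rewrite /latS /= subr0 [P1 + Q]addrC addrK opprB addrA.
Qed.

Lemma finite_poly_root_preimage (R : idomainType) (p : {poly R}) (f : nat -> R) :
  injective f -> p != 0 -> finite_set [set k | root p (f k)].
Proof.
move=> finj p0; apply: contrapT => /(infinite_set_fset (size p))[B Bsub].
apply/negP; rewrite -ltnNge -(size_map f).
apply: max_poly_roots => //; last by rewrite (map_inj_uniq finj) finmap.fset_uniq.
by apply/allP => _ /mapP[k kB ->]; apply: Bsub.
Qed.

(* In the coordinates [s] and [W] a line is [A s + B W = G]; eliminating [W]
   leaves a nonzero polynomial equation in [s] of degree at most 2. *)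
Lemma finite_hyperbola_line (R : realType) (a b d : int) (x y m : nat -> int)
    (u v : int) (l : set (R * R)) :
  d != 0 -> 0 < a ^+ 2 + b ^+ 2 - d ^+ 2 -> injective m ->
  (forall k, integral_distances a b (x k) (y k) (m k) (m k - d)) ->
  is_line l -> finite_set [set k | l (lattice_embed R (u + x k, v + y k))].
Proof.
move=> d0 D_gt0 minj Q [a0 [b0 [c0 [ab0 ->]]]].
pose r (z : int) : R := z%:~R.
pose N : R := r a ^+ 2 + r b ^+ 2.
pose D : R := N - r d ^+ 2.
have D0 : 0 < D by rewrite /D /N /r -!rmorphXn -rmorphD -rmorphB /= ltr0z.
have N0 : 0 < N by rewrite -(subrK (r d ^+ 2) N) ltr_wpDr // sqr_ge0.
have rd0 : r d != 0 by rewrite intr_eq0.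
pose A : R := r d * (a0 * r a + b0 * r b); pose B : R := b0 * r a - a0 * r b.
pose G : R := 2 * N * (c0 - a0 * r u - b0 * r v) - N * (a0 * r a + b0 * r b).
pose p : {poly R} := (A ^+ 2 - D * B ^+ 2)%:P * 'X^2 + (- 2 * A * G)%:P * 'X
  + (G ^+ 2 + D * N * B ^+ 2)%:P.
have p0 : p != 0.
  apply: contra_not_neq ab0 => p0.
  (* The constant term is a sum of nonnegative terms, so [B = G = 0]; then [p.[1] = A ^+ 2]. As
     [d <> 0], the normal [(a0, b0)] is both orthogonal and parallel to [P], hence zero. *)
  have c_0 : G ^+ 2 + D * N * B ^+ 2 = 0.
    transitivity p.[0]; last by rewrite p0 horner0.
    by rewrite /p !(hornerD, hornerM, hornerC, hornerXn, hornerX); ring.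
  have B0 : B = 0.
    move/eqP: c_0; rewrite paddr_eq0 ?sqr_ge0 //; last first.
      by rewrite mulr_ge0 ?sqr_ge0 ?mulr_ge0 ?ltW.
    move=> /andP[_]; rewrite mulf_eq0 sqrf_eq0 => /orP[|/eqP //].
    by rewrite mulf_eq0 !gt_eqF.
  have G0 : G = 0 by move: c_0; rewrite B0 expr0n mulr0 addr0 => /eqP; rewrite sqrf_eq0 => /eqP.
  have A0 : A ^+ 2 = 0.
    transitivity p.[1]; last by rewrite p0 horner0.
    by rewrite /p !(hornerD, hornerM, hornerC, hornerXn, hornerX) B0 G0; ring.
  have C0 : a0 * r a + b0 * r b = 0.
    by move/eqP: A0; rewrite sqrf_eq0 mulf_eq0 (negPf rd0) => /eqP.
  have a00 : N * a0 = 0.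
    by transitivity (r a * (a0 * r a + b0 * r b) - r b * B); [rewrite /N /B; ring |
      rewrite C0 B0; ring].
  have b00 : N * b0 = 0.
    by transitivity (r b * (a0 * r a + b0 * r b) + r a * B); [rewrite /N /B; ring |
      rewrite C0 B0; ring].
  move/eqP: a00; rewrite mulf_eq0 gt_eqF //= => /eqP ->.
  by move/eqP: b00; rewrite mulf_eq0 gt_eqF //= => /eqP ->.
pose f k := r (2 * m k - d).
have finj : injective f.
  move=> i j /intr_inj h; apply: minj; lia.
apply: sub_finite_set (finite_poly_root_preimage _ p f finj p0) => k /=.
rewrite !rmorphD /= -/(r u) -/(r v) -/(r (x k)) -/(r (y k)).
have [e1 e2] := iffLR (dist_linear _ _ _ _ _ _) (Q k).
move: e1 e2; rewrite subKr => /(congr1 r) e1 /(congr1 r) e2 line.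
pose X := r (x k); pose Y := r (y k); pose M := r (m k).
have {}e1 : M ^+ 2 = X ^+ 2 + Y ^+ 2.
  by move: e1; rewrite /r rmorphD !rmorphXn.
have {}e2 : 2 * (r a * X + r b * Y) = 2 * r d * M + D.
  move: e2; rewrite /r !(rmorphD, rmorphM, rmorphN, rmorphXn, rmorphB) /= => ->.
  by rewrite /D /N /r; ring.
pose s := f k; have sE : s = 2 * M - r d.
  by rewrite /s /f /r rmorphB rmorphM.
pose W := 2 * (r a * Y - r b * X).
have WE : W ^+ 2 = D * (s ^+ 2 - N).
  have : (2 * (r a * X + r b * Y)) ^+ 2 + W ^+ 2 = 4 * N * M ^+ 2.
    by rewrite e1 /N /W; ring.
  rewrite e2 => /(canRL (addKr _)) ->; rewrite sE /D; ring.
have sW : B * W = G - A * s.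
  rewrite /G -line -/X -/Y.
  have -> : 2 * N * (a0 * (r u + X) + b0 * (r v + Y) - a0 * r u - b0 * r v) =
     (a0 * r a + b0 * r b) * (2 * (r a * X + r b * Y)) + B * W.
    by rewrite /N /B /W; ring.
  by rewrite e2 sE /A /D; ring.
rewrite rootE /p !(hornerD, hornerM, hornerC, hornerXn, hornerX) -/s; apply/eqP.
transitivity ((G - A * s) ^+ 2 - B ^+ 2 * (D * (s ^+ 2 - N))); first by ring.
by rewrite -WE -sW; ring.
Qed.

(** Each line takes finitely many indices of the sequence, so infinitely many indices avoid all the
    lines. *)
Lemma latS_minus_lines_infinite (R : realType) (P1 P2 : lattice_point)
    (L : set (R * R)) :
  has_base (P2 - P1).1 (P2 - P1).2 -> finite_union_of_lines L ->
  infinite_set (latS R P1 P2 `\` (lattice_embed R @^-1` L)).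
Proof.
move=> /hyperbola_sequence[d [d0 D_gt0 [x [y [m [m_mono Q]]]]]] [F [Ffin Fline ->]] fin.
have minj : injective m.
  move=> i j ij; have [lt|lt|//] := ltngtP i j.
  - by have := m_mono _ _ lt; rewrite ij ltxx.
  - by have := m_mono _ _ lt; rewrite ij ltxx.
pose V k : lattice_point := P1 + (x k, y k).
have Vinj : injective V.
  (* The point determines [2 d m] by the linear equation, hence [m], as [d <> 0]. *)
  move=> i j /addrI[xx yy].
  have Em k : 2 * m k * d = 2 * ((P2 - P1).1 * x k + (P2 - P1).2 * y k)
      - ((P2 - P1).1 ^+ 2 + (P2 - P1).2 ^+ 2 - d ^+ 2).
    have [_ ->] := iffLR (dist_linear _ _ _ _ _ _) (Q k).
    by rewrite subKr; ring.
  apply: minj; apply: (mulIf d0); apply: (@mulfI _ 2) => //.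
  by rewrite !mulrA !Em xx yy.
have VS k : latS R P1 P2 (V k).
  apply: latS_translate; apply/latSP; exists `|m k|, `|m k - d|.
  by split=> //; have [e1 e2] := Q k; split; rewrite real_normK ?num_real.
apply: infinite_nat.
pose bad := \bigcup_(l in F) [set k | l (lattice_embed R (V k))].
have badfin : finite_set bad.
  apply: bigcup_finite => // l Fl.
  exact: (finite_hyperbola_line _ _ _ _ _ _ _ _ _ _ d0 D_gt0 minj Q (Fline _ Fl)).
have goodfin := finite_preimage (in2W Vinj) fin.
apply: (@sub_finite_set _ _ (bad `|` V @^-1` _)); last first.
  by rewrite finite_setU; split; [exact: badfin | exact: goodfin].
move=> k _.
have [[l Fl lk]|nk] := pselect (bad k); first by left; exists l.
by right; split=> // -[l Fl lk]; apply: nk; exists l.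
Qed.

(** * The exceptional cases, by the value of [d] *)

(** The triangle inequality squared: [c] is the inner product of [Q] and [Q - P], and [c <= m n] by
    Cauchy-Schwarz. *)
Lemma dist_gap (a b x y m n : int) : 0 <= m -> 0 <= n ->
  integral_distances a b x y m n -> (m - n) ^+ 2 <= a ^+ 2 + b ^+ 2.
Proof.
move=> m0 n0 [em en]; pose c := x * (x - a) + y * (y - b).
have : c <= m * n.
  apply: le_trans (ler_norm c) _; rewrite -ler_sqr ?nnegrE ?mulr_ge0 //.
  rewrite real_normK ?num_real // exprMn em en -subr_ge0.
  have -> : (x ^+ 2 + y ^+ 2) * ((x - a) ^+ 2 + (y - b) ^+ 2) - c ^+ 2 =
    (x * (y - b) - y * (x - a)) ^+ 2 by rewrite /c; ring.
  exact: sqr_ge0.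
have -> : (m - n) ^+ 2 = m ^+ 2 + n ^+ 2 - 2 * (m * n) by ring.
by rewrite em en /c; lia.
Qed.

Lemma latS_linear (R : realType) (a b x y : int) :
  latS R (0, 0) (a, b) (x, y) -> exists m d : int,
  [/\ m ^+ 2 = x ^+ 2 + y ^+ 2,
      2 * (a * x + b * y) = 2 * d * m + (a ^+ 2 + b ^+ 2 - d ^+ 2) &
      d ^+ 2 <= a ^+ 2 + b ^+ 2].
Proof.
move=> /latSP[m [n [m0 n0 mn]]]; exists m, (m - n).
have [-> ->] := iffLR (dist_linear _ _ _ _ _ _) mn.
by split=> //; exact: dist_gap mn.
Qed.

Lemma latS_intro (R : realType) (a b x y m n : int) :
  m ^+ 2 = x ^+ 2 + y ^+ 2 -> n ^+ 2 = (x - a) ^+ 2 + (y - b) ^+ 2 ->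
  latS R (0, 0) (a, b) (x, y).
Proof.
move=> em en; apply/latSP; exists `|m|, `|n|; split=> //.
by split; rewrite real_normK ?num_real.
Qed.

Lemma infinite_orbit (A : set lattice_point) (T : Type) (inv : T -> Prop)
    (step : T -> T) (g : T -> lattice_point) (z0 : T) : inv z0 ->
  (forall z, inv z -> [/\ inv (step z), A (g z) & (g z).2 < (g (step z)).2]) ->
  infinite_set A.
Proof.
move=> inv0 stepP fin; pose z k := iter k step z0.
have zP k : inv (z k) by elim: k => // k /stepP[].
have gmono : {homo (fun k => (g (z k)).2) : i j / (i < j)%N >-> i < j}.
  apply: homo_ltn => [u v w|k]; first exact: lt_trans.
  by have [] := stepP _ (zP k).
have ginj : injective (g \o z).
  move=> i j /= ij; have [lt|lt|//] := ltngtP i j.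
  - by have := gmono _ _ lt; rewrite ij ltxx.
  - by have := gmono _ _ lt; rewrite ij ltxx.
apply: infinite_nat; apply: sub_finite_set (finite_preimage (in2W ginj) fin) => k _.
by have [] := stepP _ (zP k).
Qed.

Lemma sqr_bound (d c : int) : 0 <= c -> d ^+ 2 < (c + 1) ^+ 2 -> - c <= d <= c.
Proof.
move=> c0; rewrite -[d ^+ 2]real_normK ?num_real // ltr_sqr ?nnegrE ?addr_ge0 //.
by rewrite ltzD1 ler_norml.
Qed.

Lemma factor_bound (u v k : int) : 0 < k -> u * v = k -> - k <= u <= k.
Proof.
move=> k0 uv; rewrite -ler_norml -(gtr0_norm k0) -uv normrM ler_peMr //.
have : v != 0 by apply: contraTneq k0 => v0; rewrite -uv v0 mulr0.
by rewrite -normr_gt0; lia.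
Qed.

Lemma latS_0_1 (R : realType) : latS R (0, 0) (0, 1) = [set Q : lattice_point | Q.1 = 0].
Proof.
apply/seteqP; split=> -[x y] /=; last first.
  by move=> ->; apply: (@latS_intro _ _ _ _ _ y (y - 1)); ring.
move=> /latS_linear[m [d [em lin dN]]].
have db : - 1 <= d <= 1 by apply: sqr_bound => //; exact: le_lt_trans dN _.
have dE : d = 0 \/ (d = 1 \/ d = -1) by clear -db; lia.
(* [d = 0] would give [2 y = 1]; otherwise [m] is [y] or [- y]. *)
case: dE => dE; first by rewrite dE in lin; clear -lin; lia.
have : x ^+ 2 = 0 by case: dE => dE; rewrite dE in lin; nia.
by move/eqP; rewrite sqrf_eq0 => /eqP.
Qed.

Lemma latS_0_2 (R : realType) : latS R (0, 0) (0, 2) = [set Q : lattice_point | Q.1 = 0].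
Proof.
apply/seteqP; split=> -[x y] /=; last first.
  by move=> ->; apply: (@latS_intro _ _ _ _ _ y (y - 2)); ring.
move=> /latS_linear[m [d [em lin dN]]].
have db : - 2 <= d <= 2 by apply: sqr_bound => //; exact: le_lt_trans dN _.
have dE : (d = 1 \/ d = -1) \/ d = 0 \/ d = 2 \/ d = -2 by clear -db; lia.
case: dE => [[|] dE|dE]; [rewrite dE in lin; clear -lin; lia..|].
have : x ^+ 2 = 0; last by move/eqP; rewrite sqrf_eq0 => /eqP.
case: dE => [dE|dE]; last by case: dE => dE; rewrite dE in lin; nia.
have yE : y = 1 by rewrite dE in lin; clear -lin; lia.
rewrite yE expr1n in em.
have mx : (m - x) * (m + x) = 1 by rewrite -subr_sqr em; ring.
have mxb := factor_bound _ _ _ ltr01 mx.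
suff -> : x = 0 by rewrite expr0n.
have [e|[e|e]] : m - x = -1 \/ m - x = 0 \/ m - x = 1 by lia.
all: by rewrite e in mx; lia.
Qed.

Lemma latS_1_1_sub (R : realType) :
  latS R (0, 0) (1, 1) `<=` [set Q : lattice_point | Q.1 + Q.2 = 1].
Proof.
move=> -[x y] /= /latS_linear[m [d [em lin dN]]].
have db : - 1 <= d <= 1 by apply: sqr_bound => //; exact: le_lt_trans dN _.
have dE : d = 0 \/ d = 1 \/ d = -1 by clear -db; lia.
by case: dE => [|[]] dE; rewrite dE in lin; clear -lin; lia.
Qed.

(** On the bisector both distances equal [n], where [(2 t - 1) ^+ 2 - 2 n ^+ 2 = -1]; the step
    multiplies [(2 t - 1) + n sqrt 2] by the unit [3 + 2 sqrt 2]. *)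
Lemma latS_1_1_infinite (R : realType) : infinite_set (latS R (0, 0) (1, 1)).
Proof.
apply: (@infinite_orbit _ (int * int)%type
  (fun z => [/\ 0 <= z.1, 1 <= z.2 & z.2 ^+ 2 = 2 * z.1 ^+ 2 - 2 * z.1 + 1])
  (fun z => (3 * z.1 + 2 * z.2 - 1, 4 * z.1 + 3 * z.2 - 2))
  (fun z => (1 - z.1, z.1)) (0, 1)) => // -[t n] /= [t0 n1 En].
split; last by lia.
- split; [lia | lia | nia].
- by apply: (@latS_intro _ _ _ _ _ n n); rewrite En; ring.
Qed.

Lemma latS_1_2 (R : realType) :
  latS R (0, 0) (1, 2) = [set (1, 0); (0, 2)] :> set lattice_point.
Proof.
apply/seteqP; split=> -[x y] /=; last first.
  move=> [] [-> ->]; first exact: (@latS_intro _ _ _ _ _ 1 2).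
  exact: (@latS_intro _ _ _ _ _ 2 1).
move=> /latS_linear[m [d [em lin dN]]].
have db : - 2 <= d <= 2 by apply: sqr_bound => //; exact: le_lt_trans dN _.
have dE : (d = 0 \/ d = 2 \/ d = -2) \/ (d = 1 \/ d = -1) by clear -db; lia.
case: dE => [[|[]] dE|dE]; [rewrite dE in lin; clear -lin; lia..|].
have m2 : m ^+ 2 = (x + 2 * y - 2) ^+ 2.
  case: dE => dE; rewrite dE in lin.
    by congr (_ ^+ 2); lia.
  by rewrite -[RHS]sqrrN; congr (_ ^+ 2); lia.
(* Here [D = 4] is a square, so the hyperbola equation factors over the integers and has finitely
   many solutions. *)
have yx : (y - 1) * (4 * x + 3 * y - 5) = 1.
  have -> : (y - 1) * (4 * x + 3 * y - 5) =
    (x + 2 * y - 2) ^+ 2 - (x ^+ 2 + y ^+ 2) + 1 by ring.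
  by rewrite -m2 em; ring.
have yb := factor_bound _ _ _ ltr01 yx.
have [yE|[yE|yE]] : y = 0 \/ y = 1 \/ y = 2 by lia.
- by left; move: yx; rewrite yE => yx; congr (_, _); clear -yx; lia.
- by move: yx; rewrite yE => yx; clear -yx; lia.
- by right; move: yx; rewrite yE => yx; congr (_, _); clear -yx; lia.
Qed.

Lemma latS_2_2_sub (R : realType) :
  latS R (0, 0) (2, 2) `<=` [set Q : lattice_point | Q.1 + Q.2 = 2].
Proof.
move=> -[x y] /= /latS_linear[m [d [em lin dN]]].
have db : - 2 <= d <= 2 by apply: sqr_bound => //; exact: le_lt_trans dN _.
have dE : (d = 1 \/ d = -1 \/ d = 0) \/ (d = 2 \/ d = -2) by clear -db; lia.
case: dE => [[|[]] dE|dE]; [rewrite dE in lin; clear -lin; lia..|].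
have m2 : m ^+ 2 = (x + y - 1) ^+ 2.
  case: dE => dE; rewrite dE in lin.
    by congr (_ ^+ 2); lia.
  by rewrite -[RHS]sqrrN; congr (_ ^+ 2); lia.
(* The hyperbolas with [d] equal to 2 or -2 have no integral point, by parity. *)
have : 2 * (x * y - x - y) + 1 = 0.
  have -> : 2 * (x * y - x - y) + 1 = (x + y - 1) ^+ 2 - (x ^+ 2 + y ^+ 2) by ring.
  by rewrite -m2 em; ring.
by move: (x * y) => xy; clear; lia.
Qed.

(** The step multiplies [s + m sqrt 2], of norm -1, by [3 + 2 sqrt 2]. *)
Lemma latS_2_2_infinite (R : realType) : infinite_set (latS R (0, 0) (2, 2)).
Proof.
apply: (@infinite_orbit _ (int * int)%type
  (fun z => [/\ 1 <= z.1, 1 <= z.2 & z.1 ^+ 2 + 1 = 2 * z.2 ^+ 2])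
  (fun z => (3 * z.1 + 4 * z.2, 2 * z.1 + 3 * z.2))
  (fun z => (1 - z.1, 1 + z.1)) (1, 1)) => // -[s m] /= [s1 m1 Em].
split; last by lia.
- split; [lia | lia | nia].
- have E : (2 * m) ^+ 2 = 2 * (s ^+ 2 + 1) by rewrite Em; ring.
  by apply: (@latS_intro _ _ _ _ _ (2 * m) (2 * m)); rewrite E; ring.
Qed.

(** The step multiplies [s + m sqrt 5], of norm -1, by the unit [9 + 4 sqrt 5]; both distances are
    [5 m]. *)
Lemma latS_2_4_line_infinite (R : realType) :
  infinite_set (latS R (0, 0) (2, 4) `&` [set Q : lattice_point | Q.1 + 2 * Q.2 = 5]).
Proof.
apply: (@infinite_orbit _ (int * int)%type
  (fun z => [/\ 1 <= z.1, 1 <= z.2 & z.1 ^+ 2 + 1 = 5 * z.2 ^+ 2])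
  (fun z => (9 * z.1 + 20 * z.2, 4 * z.1 + 9 * z.2))
  (fun z => (1 - 2 * z.1, 2 + z.1)) (2, 1)) => // -[s m] /= [s1 m1 Em].
split; last by lia.
- split; [lia | lia | nia].
- have E : (5 * m) ^+ 2 = 5 * (s ^+ 2 + 1) by rewrite Em; ring.
  split=> /=; last by ring.
  by apply: (@latS_intro _ _ _ _ _ (5 * m) (5 * m)); rewrite E; ring.
Qed.

(** Odd [d] fails by parity and [d = 0] is the line. For even [d <> 0], [D] is 16 or 4 and the
    equation factors: [|d| = 2] gives [(2, 0)] and [(0, 4)], [|d| = 4] the other two points. The
    points [(0, 2)] and [(4, 0)] are not in the set: their distances to [(2, 4)] are [sqrt 8] and
    [sqrt 20]. *)
Lemma latS_2_4 (R : realType) :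
  latS R (0, 0) (2, 4) =
  (latS R (0, 0) (2, 4) `&` [set Q : lattice_point | Q.1 + 2 * Q.2 = 5]) `|`
  [set (2, 0); (0, 4); (-1, 0); (3, 4)].
Proof.
apply/seteqP; split=> -[x y]; last first.
  move=> [[]//|/= [[[[-> ->]|[-> ->]]|[-> ->]]|[-> ->]]].
  - exact: (@latS_intro _ _ _ _ _ 2 4).
  - exact: (@latS_intro _ _ _ _ _ 4 2).
  - exact: (@latS_intro _ _ _ _ _ 1 5).
  - exact: (@latS_intro _ _ _ _ _ 5 1).
move=> S; have [m [d [em lin dN]]] := latS_linear _ _ _ _ _ S.
have db : - 4 <= d <= 4 by apply: sqr_bound => //; exact: le_lt_trans dN _.
have dE : (d = 1 \/ d = -1 \/ d = 3 \/ d = -3) \/ d = 0 \/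
  (d = 2 \/ d = -2) \/ (d = 4 \/ d = -4) by clear -db; lia.
case: dE => [[|[|[]]] dE|[dE|[dE|dE]]]; [rewrite dE in lin; clear -lin; lia..| | |].
- by left; split=> //=; rewrite dE in lin; clear -lin; lia.
- right; have m2 : m ^+ 2 = (x + 2 * y - 4) ^+ 2.
    case: dE => dE; rewrite dE in lin.
      by congr (_ ^+ 2); lia.
    by rewrite -[RHS]sqrrN; congr (_ ^+ 2); lia.
  have yx : (y - 2) * (4 * x + 3 * y - 10) = 4.
    have -> : (y - 2) * (4 * x + 3 * y - 10) =
      (x + 2 * y - 4) ^+ 2 - (x ^+ 2 + y ^+ 2) + 4 by ring.
    by rewrite -m2 em; ring.
  have yb := factor_bound _ _ _ (isT : 0 < 4 :> int) yx.
  clear -yx yb; have yE : y = 0 \/ y = 4 \/ y = -2 \/ y = -1 \/ y = 1 \/ y = 2 \/ y = 3 \/ y = 5 \/ y = 6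
    by lia.
  case: yE => [|[|yE]]; last by exfalso; do ?[case: yE => yE]; move: yx; rewrite yE => yx; clear -yx; lia.
  + by move=> yE; left; left; left; move: yx; rewrite yE => yx; congr (_, _); clear -yx; lia.
  + by move=> yE; left; left; right; move: yx; rewrite yE => yx; congr (_, _); clear -yx; lia.
- right; have m2 : (2 * m) ^+ 2 = (x + 2 * y - 1) ^+ 2.
    case: dE => dE; rewrite dE in lin.
      by congr (_ ^+ 2); lia.
    by rewrite -[RHS]sqrrN; congr (_ ^+ 2); lia.
  have xy : (x - 1) * (4 * y - 3 * x - 5) = 4.
    have -> : (x - 1) * (4 * y - 3 * x - 5) =
      (x + 2 * y - 1) ^+ 2 - 4 * (x ^+ 2 + y ^+ 2) + 4 by ring.
    by rewrite -m2 -em; ring.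
  have xb := factor_bound _ _ _ (isT : 0 < 4 :> int) xy.
  clear -xy xb; have xE : x = -1 \/ x = 3 \/ x = -3 \/ x = -2 \/ x = 0 \/ x = 1 \/ x = 2 \/ x = 4 \/ x = 5
    by lia.
  case: xE => [|[|xE]]; last by exfalso; do ?[case: xE => xE]; move: xy; rewrite xE => xy; clear -xy; lia.
  + by move=> xE; left; right; move: xy; rewrite xE => xy; congr (_, _); clear -xy; lia.
  + by move=> xE; right; move: xy; rewrite xE => xy; congr (_, _); clear -xy; lia.
Qed.

Theorem theorem1p2 (R : realType) (P1 P2 : lattice_point) (hP : P1 <> P2) :
  let P : lattice_point := P2 - P1 in
  let O : lattice_point := (0, 0) in
  let S : set lattice_point := latS R O P in
  (~ exceptional P ->
     forall L : set (R * R), finite_union_of_lines L ->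
       infinite_set (latS R P1 P2 `\` (lattice_embed R @^-1` L))) /\
  (P = (0, 1) -> S = [set Q : lattice_point | Q.1 = 0]) /\
  (P = (1, 1) -> infinite_set S /\ S `<=` [set Q : lattice_point | Q.1 + Q.2 = 1]) /\
  (P = (0, 2) -> S = [set Q : lattice_point | Q.1 = 0]) /\
  (P = (1, 2) -> S = [set (1, 0); (0, 2)]) /\
  (P = (2, 2) -> infinite_set S /\ S `<=` [set Q : lattice_point | Q.1 + Q.2 = 2]) /\
  (P = (2, 4) ->
     exists T : set lattice_point,
       [/\ infinite_set T, T `<=` [set Q : lattice_point | Q.1 + 2 * Q.2 = 5] &
           S = T `|` [set (2, 0); (0, 4); (-1, 0); (3, 4)]]).
Proof.
move=> P O S; split.
  move=> Pexc L; apply: latS_minus_lines_infinite.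
  by apply: has_base_nonexceptional => // /eqP; rewrite subr_eq0 => /eqP /esym.
rewrite /S; split; first by move=> ->; exact: latS_0_1.
split; first by move=> ->; split; [exact: latS_1_1_infinite | exact: latS_1_1_sub].
split; first by move=> ->; exact: latS_0_2.
split; first by move=> ->; exact: latS_1_2.
split; first by move=> ->; split; [exact: latS_2_2_infinite | exact: latS_2_2_sub].
move=> ->; exists (latS R O (2, 4) `&` [set Q : lattice_point | Q.1 + 2 * Q.2 = 5]).
by split; [exact: latS_2_4_line_infinite | exact: subIsetr | exact: latS_2_4].
Qed.
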